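(* Let $R > \frac12$ be a fixed real number. Then $$\chi(B^{n+1}_R) \le (x(R)+o(1))^n \qquad (n\to\infty),$$ i.e. there is a sequence of real numbers $\varepsilon_n\to 0$ (depending on $R$) such that $\chi(B^{n+1}_R)\le (x(R)+\varepsilon_n)^n$ for all $n$, where $$x(R) = \begin{cases} \sqrt{5 - \frac{2}{R^2} + 4\sqrt{1-\frac{5R^2-1}{4R^4}}}, & R > \frac{\sqrt 5}{2},\\[4pt] 2R, & \frac12 < R \le \frac{\sqrt5}{2}.\end{cases}$$
   Context: $B^{n+1}_R\subset\mathbb{R}^{n+1}$ is the Euclidean ball of radius $R$ centered at the origin. $\chi(B^{n+1}_R)$ is the minimal number of colors needed to color all points of $B^{n+1}_R$ in such a way that any two points of $B^{n+1}_R$ at Euclidean distance exactly $1$ have different colors. The quantity $o(1)$ is for fixed $R$ as $n\to\infty$. *)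

(* Defs.v *)
From mathcomp Require Import all_boot all_order all_algebra.
From mathcomp Require Import all_classical all_reals all_analysis.
Import Order.TTheory GRing.Theory Num.Theory.
Import numFieldNormedType.Exports.

Set Implicit Arguments.
Unset Strict Implicit.
Unset Printing Implicit Defensive.

Local Open Scope classical_set_scope.
Local Open Scope ring_scope.

(* The library norm `|v| on 'rV[R]_d is the sup norm, hence a separate
   Euclidean norm. *)
Definition enorm (R : realType) (d : nat) (v : 'rV[R]_d) : R :=
  Num.sqrt (\sum_(i < d) v 0 i ^+ 2).

Definition eball (R : realType) (d : nat) (r : R) : set 'rV[R]_d :=
  [set v | enorm v <= r].

Definition unit_colorable (R : realType) (d : nat) (E : set 'rV[R]_d)
    (k : nat) : Prop :=
  exists c : E -> 'I_k,
    forall u v : E, enorm (val u - val v) = 1 -> c u <> c v.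

(* Minimum of a set of naturals, equal to +oo when no finite number of
   colors suffices. *)
Definition chi (R : realType) (d : nat) (E : set 'rV[R]_d) : \bar R :=
  ereal_inf [set (k%:R)%:E | k in [set k | unit_colorable E k]].

Definition xbase (R : realType) (r : R) : R :=
  if Num.sqrt 5 / 2 < r then
    Num.sqrt (5 - 2 / r ^+ 2
              + 4 * Num.sqrt (1 - (5 * r ^+ 2 - 1) / (4 * r ^+ 4)))
  else 2 * r.

(* Main.v *)
Require Import Defs.
From mathcomp Require Import all_boot all_order all_algebra.
From mathcomp Require Import zify ring lra.
From mathcomp Require Import all_classical all_reals all_analysis.
Import Order.TTheory GRing.Theory Num.Theory.
Import numFieldNormedType.Exports.

(** The ball is cut into the open ball of radius 1/2, which needs one color,
    and a bounded number of thin shells of inner radius [s], where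
    [1 / 2 <= s <= r].  In a thin shell only directions matter, and forbidding
    distance 1 becomes forbidding a small range of angles around [2 * gamma],
    where [sin gamma = 1 / (2 * s)].

    Color classes are built one centre at a time.  A centre [y] captures the
    points at angle at most [alpha] from [y], with [alpha] slightly below
    [gamma], and excludes all other points at angle at most [beta], with [beta]
    slightly above [3 * gamma].  Two points captured by the same centre are at
    angle at most [2 * alpha], hence closer than 1; a captured point and a point
    that the same centre neither captures nor excludes are at angle more than
    [beta - alpha], hence farther apart than 1 (lemmas [captured_pair] and
    [unaffected_pair]).  So the points captured by successive centres form one
    color class, as each centre works on the points left over by the previous
    ones.

    Everything then rests on one density: when the centres are spread uniformly,
    the proportion [p] of the centres capturing a given point among those
    affecting it is [(sin alpha / sin beta) ^ n] up to a subexponential factor.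
    By double counting, some centre captures at least the fraction [p] of the
    remaining points that it affects, so some color class contains at least the
    fraction [p] of any finite set of points ([capture]).  Removing such classes
    repeatedly colors a finite net of the shell with about [log N / p] colors,
    [N] being the size of the net ([greedy_cover]); as [log N] is polynomial in
    the dimension, the base of the exponential is [sin beta / sin alpha], close
    to [sin (3 * gamma) / sin gamma = 3 - 1 / s ^ 2].  When [s] is close to 1 or
    smaller, [3 * gamma] reaches a right angle; then a centre excludes every
    other point and the base is [1 / sin alpha], close to [2 * s].  Both bases
    are at most [xbase r] ([xbase_small], [xbase_large]).

    The centres are the integer points of a large Euclidean ball, and volumes
    are compared by counting.  If [v / u] is a positive rational, dividing
    integer points by [u], rounding and multiplying by [v] shows that a region
    containing all the integer points near a translate of [(v / u) * S] has at
    least [(v / u) ^ d] times as many of them as [S] ([lattice_scaling]).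
    A cone of angle [beta] truncated by the ball is cut into boundedly many
    slabs, and each slab, contracted by a ratio just below
    [sin alpha / sin beta], fits inside the cone of angle [alpha] with the same
    axis ([slab_count], [cone_count]).  Since only translations and homotheties
    occur, the direction of the axis is irrelevant and no invariance under
    rotations enters the argument. *)

Set Implicit Arguments.
Unset Strict Implicit.
Unset Printing Implicit Defensive.
Local Open Scope ring_scope.

(** * Greedy color classes in a finite set *)

Section Combinatorics.
Local Open Scope nat_scope.

Lemma count_sum_card (I : finType) (T : eqType) (Y : seq T) (B : T -> pred I)
    (F : {set I}) :
  \sum_(y <- Y) #|[set i in F | B y i]%SET| = \sum_(i in F) count (B^~ i) Y.
Proof.
have -> : \sum_(y <- Y) #|[set i in F | B y i]%SET| =
    \sum_(y <- Y) \sum_(i in F) (B y i : nat).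
  apply: eq_bigr => y _; rewrite -sum1_card big_mkcond [RHS]big_mkcond /=.
  by apply: eq_bigr => i _; rewrite inE; case: (i \in F); case: (B y i).
rewrite exchange_big /=; apply: eq_bigr => i _.
by rewrite -sumn_count sumnE big_map.
Qed.

(** Double counting of the affected pairs: if every centre captured less than a
    fraction [1 / C] of the points that it affects, some point would be captured
    by less than a fraction [1 / C] of the centres affecting it. *)
Lemma best_centre (I : finType) (T : eqType) (Y : seq T) (A B : T -> pred I)
    (C : nat) (F : {set I}) :
  (forall y i, A y i -> B y i) ->
  (forall i, i \in F -> 0 < count (B^~ i) Y <= C * count (A^~ i) Y) ->
  0 < #|F| ->
  exists2 y, y \in Y &
    0 < #|[set i in F | B y i]%SET| <= C * #|[set i in F | A y i]%SET|.
Proof.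
move=> sAB hC F0.
pose b y := #|[set i in F | B y i]%SET|; pose a y := #|[set i in F | A y i]%SET|.
apply/hasP; apply: contraT => /hasPn hn.
have le_sum : \sum_(y <- Y) b y <= C * \sum_(y <- Y) a y.
  rewrite !count_sum_card big_distrr /=.
  by apply: leq_sum => i iF; case/andP: (hC i iF).
have lt_sum : \sum_(y <- Y) (C * a y + (0 < b y)) <= \sum_(y <- Y) b y.
  rewrite big_seq_cond [X in _ <= X]big_seq_cond; apply: leq_sum => y /andP[yY _].
  have := hn y yY; rewrite -/(b y) -/(a y).
  have : a y <= b y.
    apply: subset_leq_card; apply/fintype.subsetP => i; rewrite !inE => /andP[-> /=].
    exact: sAB.
  by case: (b y) => [|k]; nia.
have [i0 i0F] : exists i, i \in F by apply/card_gt0P.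
have [y0 y0Y By0] : exists2 y, y \in Y & B y i0.
  by apply/hasP; rewrite has_count; case/andP: (hC i0 i0F).
have pos : 0 < \sum_(y <- Y) (0 < b y).
  rewrite lt0n sum_nat_seq_neq0; apply/hasP; exists y0 => //=.
  by rewrite eqb0 negbK; apply/card_gt0P; exists i0; rewrite inE i0F.
by move: lt_sum; rewrite big_split /= -big_distrr /=; lia.
Qed.

(** A best centre [y] is chosen, all the points that it affects are set aside,
    and the choice is repeated on the rest.  Each step captures at least a
    fraction [1 / C] of what it sets aside, and a point captured later than
    another is not affected by the centre of the earlier one. *)
Lemma capture (I : finType) (T : eqType) (Y : seq T) (A B : T -> pred I)
    (C : nat) (F : {set I}) :
  (forall y i, A y i -> B y i) ->
  (forall i, i \in F -> 0 < count (B^~ i) Y <= C * count (A^~ i) Y) ->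
  exists Phi : {set I}, [/\ Phi \subset F, #|F| <= C * #|Phi| &
    forall i j, i \in Phi -> j \in Phi -> exists y,
      [\/ A y i /\ A y j, A y i /\ ~~ B y j | A y j /\ ~~ B y i]].
Proof.
move=> sAB; have [n] := ubnP #|F|; elim: n F => // n IHn F /ltnSE leFn hC.
have [F0|F0] := posnP #|F|.
  by exists finset.set0; split; rewrite ?finset.sub0set ?F0 // => i j; rewrite inE.
have [y yY /andP[b0 ba]] := best_centre sAB hC F0.
set Fb := [set i in F | B y i]%SET in b0 ba; set Fa := [set i in F | A y i]%SET in ba.
have sbF : Fb \subset F by apply/fintype.subsetP => i; rewrite inE => /andP[].
have sab : Fa \subset Fb.
  by apply/fintype.subsetP => i; rewrite !inE => /andP[-> /=]; apply: sAB.
have cF : #|F| = #|Fb| + #|F :\: Fb|.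
  by rewrite -(cardsID Fb F) (finset.setIidPr sbF).
have [|i|Phi [sPhi cPhi hPhi]] := IHn (F :\: Fb); first by lia.
  by rewrite inE => /andP[_]; apply: hC.
have sPF : Phi \subset F by apply: fintype.subset_trans sPhi (finset.subsetDl _ _).
have nB i : i \in Phi -> ~~ B y i.
  by move=> /(fintype.subsetP sPhi); rewrite !inE => /andP[nb iF]; rewrite iF in nb.
exists (Fa :|: Phi); split.
- by rewrite finset.subUset sPF (fintype.subset_trans sab sbF).
- rewrite cardsU (_ : Fa :&: Phi = finset.set0); first by rewrite cards0 subn0 mulnDr cF leq_add.
  apply/finset.setP => i; rewrite !inE; apply/negP => /andP[/andP[_ Ai] /nB].
  by rewrite sAB.
- move=> i j; rewrite !inE => /orP[/andP[_ Ai]|iP] /orP[/andP[_ Aj]|jP].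
  + by exists y; constructor 1.
  + by exists y; constructor 2; split => //; apply: nB.
  + by exists y; constructor 3; split => //; apply: nB.
  + exact: hPhi.
Qed.

(** This is [(1 - 1 / C) ^ C <= 1 / 2]. *)
Lemma pred_expn_half C : 0 < C -> 2 * C.-1 ^ C <= C ^ C.
Proof.
case: C => // k _ /=.
have : k ^ k.+1 + k.+1 * k ^ k <= k.+1 ^ k.+1.
  have -> : k.+1 ^ k.+1 = (k + 1) ^ k.+1 by rewrite addn1.
  rewrite expnDn big_ord_recl big_ord_recl /=.
  by rewrite subn0 !bin0 /bump /= bin1 exp1n !subn1 /=; nia.
by rewrite expnS; nia.
Qed.

(** Removing a good set of at least a fraction [1 / C] of what remains, [C] times
    in a row, halves the number of remaining points; [m] halvings exhaust [I]. *)
Lemma greedy_cover (I : finType) (G : I -> I -> Prop) (C m : nat) :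
  (forall F : {set I}, exists Phi : {set I}, [/\ Phi \subset F,
     #|F| <= C * #|Phi| & forall i j, i \in Phi -> j \in Phi -> G i j]) ->
  #|I| < 2 ^ m ->
  exists c : I -> nat, (forall i, c i < C * m) /\
    (forall i j, c i = c j -> G i j).
Proof.
move=> hG Im.
have step t : exists (c : I -> nat) (U : {set I}),
    [/\ forall i, i \notin U -> c i < t,
        forall i j, i \notin U -> j \notin U -> c i = c j -> G i j &
        C ^ t * #|U| <= C.-1 ^ t * #|I|].
  elim: t => [|t [c [U [ct cG cU]]]].
    exists (fun=> 0), [set: I]%SET; split.
    - by move=> i; rewrite inE.
    - by move=> i j; rewrite inE.
    - by rewrite cardsT.
  have [Phi [sPhi cPhi gPhi]] := hG U.
  exists (fun i => if i \in U then t else c i), (U :\: Phi); split.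
  - by move=> i _; case: ifPn => // /ct /leqW.
  - move=> i j; rewrite !inE !negb_and !negbK.
    case: (boolP (i \in U)) => iU; case: (boolP (j \in U)) => jU; rewrite ?orbF.
    + by move=> iP jP _; apply: gPhi.
    + by move=> _ _ e; have := ct j jU; rewrite -e ltnn.
    + by move=> _ _ e; have := ct i iU; rewrite e ltnn.
    + by move=> _ _; apply: cG.
  - have := cardsID Phi U; rewrite (finset.setIidPr sPhi) => cUD.
    rewrite !expnS -!mulnA.
    have h : C * #|U :\: Phi| <= C.-1 * #|U| by case: C cPhi {hG cU} => [|k] /=; nia.
    apply: leq_trans (leq_mul (leqnn C.-1) cU).
    by rewrite mulnCA [X in _ <= X]mulnCA leq_mul2l h orbT.
have [I0|I0] := posnP #|I|.
  exists (fun=> 0); split=> i; exfalso; move: (fintype.card0_eq I0 i); by rewrite inE.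
have C0 : 0 < C.
  by have [Phi [_ ]] := hG [set: I]%SET; rewrite cardsT; case: C {hG step} => //; lia.
have [c [U [ct cG cU]]] := step (C * m).
have U0 i : i \notin U.
  apply/negP => iU; have U1 : 0 < #|U| by apply/card_gt0P; exists i.
  have h : 2 ^ m * C.-1 ^ (C * m) <= C ^ (C * m).
    case: (m) => [|k]; first by rewrite muln0.
    by rewrite !expnM -expnMn leq_exp2r // pred_expn_half.
  have hp : 0 < C ^ (C * m) by rewrite expn_gt0 C0.
  have h2 : 2 ^ m * (C ^ (C * m) * #|U|) <= C ^ (C * m) * #|I|.
    apply: leq_trans (leq_mul (leqnn _) cU) _.
    by rewrite mulnA leq_mul2r h orbT.
  by move: h2 hp; nia.
exists c; split=> [i|i j]; [exact: ct | exact: cG].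
Qed.

End Combinatorics.

(** * Counting integer points under a homothety *)

(** Writing [z = u * q + m] with [0 <= m < u] coordinatewise, the points
    [v * q + tau + k], with [0 <= k < v], all lie in [T].  The map sending [(z, k)]
    to such a point together with the remainder [m] is injective. *)
Lemma lattice_scaling d (u v : nat) (tau : 'rV[int]_d) (S T : seq 'rV[int]_d) :
  (0 < u)%N -> (0 < v)%N -> uniq S ->
  (forall z w : 'rV[int]_d, z \in S ->
     (forall j, `|u%:Z * (w 0 j - tau 0 j) - v%:Z * z 0 j| < u%:Z * v%:Z) ->
     w \in T) ->
  (size S * v ^ d <= size T * u ^ d)%N.
Proof.
case: u => // u _; case: v => // v _ uS hST.
pose w (p : 'rV[int]_d * {ffun 'I_d -> 'I_v.+1}) : 'rV[int]_d :=
  \row_j (v.+1%:Z * (p.1 0%R j %/ u.+1%:Z)%Z + (p.2 j : nat)%:Z + tau 0 j).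
pose r (p : 'rV[int]_d * {ffun 'I_d -> 'I_v.+1}) : {ffun 'I_d -> 'I_u.+1} :=
  [ffun j => inord `|(p.1 0%R j %% u.+1%:Z)%Z|%N].
pose f p := (w p, r p).
pose L1 := [seq (z, e) | z <- S, e <- enum {ffun 'I_d -> 'I_v.+1}].
pose L2 := [seq (z, e) | z <- T, e <- enum {ffun 'I_d -> 'I_u.+1}].
have modz_bd (a : int) : 0 <= (a %% u.+1%:Z)%Z < u.+1%:Z.
  by rewrite modz_ge0 //= ltz_pmod.
have rE p j : ((r p j : nat)%:Z = (p.1 0%R j %% u.+1%:Z)%Z).
  rewrite ffunE inordK; first by have := modz_bd (p.1 0 j); lia.
  by have := modz_bd (p.1 0 j); lia.
have f_inj : injective f.
  move=> [z e] [z' e'] [/rowP ew er].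
  have key j : (z 0 j = z' 0 j) /\ (e j = e' j).
    have := ew j; rewrite !mxE /= => /addIr h.
    have er' : (z 0%R j %% u.+1%:Z = z' 0%R j %% u.+1%:Z)%Z.
      by rewrite -(rE (z, e)) -(rE (z', e')) er.
    have hq : (z 0%R j %/ u.+1%:Z = z' 0%R j %/ u.+1%:Z)%Z.
      have := congr1 (fun x => (x %/ v.+1%:Z)%Z) h.
      have e0 (k : 'I_v.+1) : ((k : nat)%:Z %/ v.+1%:Z)%Z = 0.
        by rewrite divz_small //= ltz_nat ltn_ord.
      by rewrite ![v.+1%:Z * _]mulrC !divzMDl // !e0 !addr0.
    split; first by rewrite (divz_eq (z 0 j) u.+1%:Z) (divz_eq (z' 0 j) u.+1%:Z) hq er'.
    by apply: val_inj; move: h; rewrite hq => /addrI [].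
  congr (_, _); first by apply/rowP => j; case: (key j).
  by apply/ffunP => j; case: (key j).
have sz (n k : nat) (X : seq 'rV[int]_d) :
    size [seq (z, e) | z <- X, e <- enum {ffun 'I_d -> 'I_k.+1}]
    = (size X * k.+1 ^ d)%N.
  by rewrite size_allpairs -cardE card_ffun !card_ord.
rewrite -(sz 0%N) -[leqRHS](sz 0%N) -(size_map f); apply: uniq_leq_size.
  rewrite map_inj_uniq //; apply: allpairs_uniq => //; first exact: enum_uniq.
  by move=> [? ?] [? ?].
move=> _ /mapP[_ /allpairsP[[z e] /= [zS _ ->]] ->].
apply/allpairsP; exists (w (z, e), r (z, e)); split=> //; last by rewrite mem_enum.
apply: hST zS _ => j; rewrite mxE /= addrK.
have := divz_eq (z 0 j) u.+1%:Z; have := modz_bd (z 0 j).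
set q := (z 0%R j %/ _)%Z; set m := (z 0%R j %% _)%Z => hm ->.
have := ltn_ord (e j); set k := (e j : nat) => hk.
rewrite (_ : _ - _ = u.+1%:Z * k%:Z - v.+1%:Z * m); last by ring.
by case/andP: hm; nia.
Qed.

(** * Euclidean geometry of row vectors *)

Section Euclid.
Variables (R : realType) (d : nat).
Implicit Types (x y z : 'rV[R]_d) (c : R).

Definition dot x y : R := \sum_j x 0 j * y 0 j.

Lemma dotC x y : dot x y = dot y x.
Proof. by apply: eq_bigr => j _; rewrite mulrC. Qed.

Lemma dotDl x y z : dot (x + y) z = dot x z + dot y z.
Proof. by rewrite -big_split; apply: eq_bigr => j _; rewrite mxE mulrDl. Qed.

Lemma dotZl c x y : dot (c *: x) y = c * dot x y.
Proof. by rewrite /dot big_distrr /=; apply: eq_bigr => j _; rewrite mxE mulrA. Qed.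

Lemma dotNl x y : dot (- x) y = - dot x y.
Proof. by rewrite -scaleN1r dotZl mulN1r. Qed.

Lemma dotBl x y z : dot (x - y) z = dot x z - dot y z.
Proof. by rewrite dotDl dotNl. Qed.

Lemma dotDr x y z : dot x (y + z) = dot x y + dot x z.
Proof. by rewrite dotC dotDl !(dotC x). Qed.

Lemma dotZr c x y : dot x (c *: y) = c * dot x y.
Proof. by rewrite dotC dotZl dotC. Qed.

Lemma dotBr x y z : dot x (y - z) = dot x y - dot x z.
Proof. by rewrite dotC dotBl !(dotC x). Qed.

Lemma dot_ge0 x : 0 <= dot x x.
Proof. by apply: sumr_ge0 => j _; rewrite -expr2 sqr_ge0. Qed.

Lemma enormE x : enorm x = Num.sqrt (dot x x).
Proof. by congr Num.sqrt; apply: eq_bigr => j _; rewrite expr2. Qed.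

Lemma enorm_ge0 x : 0 <= enorm x.
Proof. exact: sqrtr_ge0. Qed.

Lemma sqr_enorm x : enorm x ^+ 2 = dot x x.
Proof. by rewrite enormE sqr_sqrtr // dot_ge0. Qed.

Lemma cauchy_schwarz x y : dot x y ^+ 2 <= dot x x * dot y y.
Proof.
have [y0|y0] := eqVneq (dot y y) 0.
  have h0 : forall j, y 0 j = 0.
    move=> j; apply/eqP; rewrite -sqrf_eq0 expr2; apply/eqP.
    by apply: (psumr_eq0P _ y0) => // i _; rewrite -expr2 sqr_ge0.
  by rewrite y0 mulr0 /dot big1 ?expr0n // => j _; rewrite h0 mulr0.
have yp : 0 < dot y y by rewrite lt_def y0 dot_ge0.
have := dot_ge0 (dot y y *: x - dot x y *: y).
rewrite !(dotBl, dotBr, dotZl, dotZr) (dotC y x).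
rewrite (_ : _ - _ = dot y y * (dot x x * dot y y - dot x y ^+ 2)); last by ring.
by rewrite pmulr_rge0 // subr_ge0.
Qed.

Lemma dot_le x y : dot x y <= enorm x * enorm y.
Proof.
apply: le_trans (ler_norm _) _.
rewrite -[leRHS]ger0_norm ?mulr_ge0 ?enorm_ge0 // -ler_sqr ?nnegrE ?normr_ge0 //.
by rewrite !real_normK ?num_real // exprMn !sqr_enorm cauchy_schwarz.
Qed.

Lemma enormZ c x : enorm (c *: x) = `|c| * enorm x.
Proof.
rewrite !enormE dotZl dotZr mulrA -expr2 sqrtrM ?sqr_ge0 //.
by rewrite sqrtr_sqr.
Qed.

Lemma enormN x : enorm (- x) = enorm x.
Proof. by rewrite -scaleN1r enormZ normrN1 mul1r. Qed.

Lemma enorm_distC x y : enorm (x - y) = enorm (y - x).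
Proof. by rewrite -enormN opprB. Qed.

Lemma enormD x y : enorm (x + y) <= enorm x + enorm y.
Proof.
rewrite -ler_sqr ?nnegrE ?addr_ge0 ?enorm_ge0 //.
rewrite sqrrD !sqr_enorm !(dotDl, dotDr) (dotC y x).
by have := dot_le x y; lra.
Qed.

Lemma enormB_le x y z : enorm (x - z) <= enorm (x - y) + enorm (y - z).
Proof. by rewrite (_ : x - z = x - y + (y - z)) ?enormD // addrA subrK. Qed.

Lemma entry_le_enorm x j : `|x 0 j| <= enorm x.
Proof.
rewrite -ler_sqr ?nnegrE ?enorm_ge0 // real_normK ?num_real // sqr_enorm /dot.
rewrite (bigD1 j) //= -expr2 lerDl; apply: sumr_ge0 => i _.
by rewrite -expr2 sqr_ge0.
Qed.

Lemma enorm_le_entries x c :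
  (forall j, `|x 0 j| <= c) -> 0 <= c -> enorm x <= c * d%:R.
Proof.
move=> hx c0; rewrite -ler_sqr ?nnegrE ?mulr_ge0 ?ler0n ?enorm_ge0 //.
rewrite sqr_enorm; apply: (@le_trans _ _ (\sum_(j < d) c ^+ 2)).
  apply: ler_sum => j _; rewrite -expr2 -[leLHS]real_normK ?num_real //.
  by rewrite ler_sqr ?nnegrE.
rewrite sumr_const card_ord exprMn -[leLHS]mulr_natr.
apply: ler_wpM2l; first exact: sqr_ge0.
by rewrite -natrX ler_nat; case: (d) => // n; rewrite leq_pmulr.
Qed.

(** Cauchy-Schwarz for the components of [x] and [y] orthogonal to [z]; this is
    the triangle inequality for angles, in algebraic form. *)
Lemma gram3 x y z : dot x x = 1 -> dot y y = 1 -> dot z z = 1 ->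
  (dot x y - dot x z * dot y z) ^+ 2
    <= (1 - dot x z ^+ 2) * (1 - dot y z ^+ 2).
Proof.
move=> x1 y1 z1; have := cauchy_schwarz (x - dot x z *: z) (y - dot y z *: z).
rewrite !(dotBl, dotBr, dotZl, dotZr) x1 y1 z1 (dotC z x) (dotC z y).
rewrite -subr_ge0 => h; rewrite -subr_ge0; apply: le_trans h _.
by rewrite le_eqVlt; apply/orP; left; apply/eqP; ring.
Qed.

Lemma sqr_enormB x y : dot x x = 1 -> dot y y = 1 ->
  enorm (x - y) ^+ 2 = 2 - 2 * dot x y.
Proof. by move=> x1 y1; rewrite sqr_enorm !(dotBl, dotBr) x1 y1 (dotC y x); ring. Qed.

End Euclid.

(** * Integer points in cones *)

Section Cones.
Variable R : realType.

Definition emb d (z : 'rV[int]_d) : 'rV[R]_d := map_mx intr z.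

Lemma sqr_enorm_split d (e x : 'rV[R]_d) : dot e e = 1 ->
  enorm x ^+ 2 = dot e x ^+ 2 + enorm (x - dot e x *: e) ^+ 2.
Proof.
move=> e1; rewrite !sqr_enorm !(dotBl, dotBr, dotZl, dotZr) e1 (dotC x e); ring.
Qed.

(** A slab [S] of a cone with axis [e], at scale [M], is contracted by [v / u] and
    translated along [e] to the height [(a + 2 * xi) * M].  The margin [xi] absorbs
    the thickness of the slab as well as the rounding errors, which have size
    [(v + 1) * d]; with [s] the sine of the angle whose cosine is [a], the two
    hypotheses on [xi] say that the contracted slab stays inside both the narrow
    cone and the ball of radius [M]. *)
Lemma slab_count d (u v : nat) (a s q xi M c : R) (e : 'rV[R]_d)
    (S T : seq 'rV[int]_d) :
  (0 < v <= u)%N -> 0 <= a -> 0 < s -> a ^+ 2 + s ^+ 2 = 1 -> 0 <= q ->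
  0 < xi -> q * v%:R / u%:R + xi <= s ->
  (a + 4 * xi) ^+ 2 + (q * v%:R / u%:R + xi) ^+ 2 <= 1 ->
  0 < M -> (v%:R + 1) * d%:R <= xi * M ->
  dot e e = 1 -> uniq S ->
  (forall z, z \in S -> c <= dot e (emb z) <= c + xi * M /\
     enorm (emb z) ^+ 2 - dot e (emb z) ^+ 2 <= (q * M) ^+ 2) ->
  (forall w, w != 0 -> enorm (emb w) <= M ->
     a * enorm (emb w) <= dot e (emb w) -> w \in T) ->
  (size S * v ^ d <= size T * u ^ d)%N.
Proof.
move=> /andP[v0 vu] a0 s0 as1 q0 xi0 qs qa M0 dM e1 uS hS hT.
have u0 : (0 < u)%N by apply: leq_trans vu.
have uR : 0 < u%:R :> R by rewrite ltr0n.
set k := v%:R / u%:R : R.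
have k0 : 0 <= k by rewrite divr_ge0 ?ler0n.
have k1 : k <= 1 by rewrite ler_pdivrMr // mul1r ler_nat.
rewrite -mulrA -/k in qs qa.
set lam := (a + 2 * xi) * M - k * c.
pose tau : 'rV[int]_d := \row_j Num.floor (lam * e 0 j).
apply: (lattice_scaling (tau := tau)) => // z w zS hw.
have [/andP[hc1 hc2] hperp] := hS z zS.
set err := emb w - k *: emb z - lam *: e.
(* [err] collects the rounding of [tau] and the lattice error in [hw]. *)
have err_le : enorm err <= xi * M.
  apply: le_trans dM; apply: enorm_le_entries => [j|]; last by rewrite addr_ge0 ?ler0n.
  rewrite /err !mxE.
  have h1 : `|(w 0 j)%:~R - (tau 0 j)%:~R - k * (z 0 j)%:~R| <= v%:R :> R.
    rewrite -(ler_pM2l uR) -[X in X * `|_|]gtr0_norm // -normrM mulrBr mulrA.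
    rewrite (_ : u%:R * k = v%:R); last by rewrite mulrC divfK ?gt_eqF.
    have := hw j; rewrite -(ltr_int R) => /ltW.
    by rewrite intr_norm !(rmorphB, rmorphM).
  have /andP[f1 f2] := floor_itv (lam * e 0 j).
  move: h1; rewrite !mxE !ler_norml => /andP[h1 h2].
  by rewrite rmorphD /= in f2; apply/andP; split; lra.
have wE : emb w = k *: emb z + lam *: e + err.
  by apply/rowP => j; rewrite /err !mxE; ring.
have dw : dot e (emb w) = k * dot e (emb z) + lam + dot e err.
  by rewrite wE !dotDr !dotZr e1 mulr1.
have en1 : enorm e = 1 by rewrite enormE e1 sqrtr1.
have derr : - (xi * M) <= dot e err <= xi * M.
  apply/andP; split; last by apply: le_trans (dot_le _ _) _; rewrite en1 mul1r.
  rewrite lerNl -mulN1r -dotZr scaleN1r; apply: le_trans (dot_le _ _) _.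
  by rewrite en1 mul1r enormN.
set om := dot e (emb w) in dw.
have omb : (a + xi) * M <= om <= (a + 4 * xi) * M.
  have h : 0 <= k * (dot e (emb z) - c) <= xi * M.
    have xm : 0 <= xi * M by rewrite mulr_ge0 ?ltW.
    apply/andP; split; first by rewrite mulr_ge0 // subr_ge0.
    by apply: le_trans (ler_piMl xm k1); rewrite ler_wpM2l // lerBlDl.
  by case/andP: derr h => e2 e3 /andP[h1 h2]; rewrite dw /lam; apply/andP; split; lra.
have perp : enorm (emb w - om *: e) <= (q * k + xi) * M.
  rewrite (_ : emb w - _ = k *: (emb z - dot e (emb z) *: e) + (err - dot e err *: e)).
    apply: le_trans (enormD _ _) _; rewrite mulrDl; apply: lerD.
      rewrite enormZ ger0_norm // [q * k]mulrC -(mulrA k q M) ler_wpM2l //.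
      rewrite -ler_sqr ?nnegrE ?enorm_ge0 ?mulr_ge0 ?(ltW M0) //.
      by have := sqr_enorm_split (emb z) e1; lra.
    apply: le_trans err_le; rewrite -ler_sqr ?nnegrE ?enorm_ge0 //.
    by have := sqr_enorm_split err e1; have := sqr_ge0 (dot e err); lra.
  rewrite dw wE !scalerDl scalerBr scalerA.
  by apply/rowP => j; rewrite !mxE; ring.
have perp0 := enorm_ge0 (emb w - om *: e).
have wsq := sqr_enorm_split (emb w) e1; rewrite -/om in wsq.
have om0 : 0 < om.
  by case/andP: omb => h _; apply: lt_le_trans h; rewrite mulr_gt0 // ltr_wpDl.
set p := enorm (emb w - om *: e) in perp perp0 wsq.
case/andP: omb => om1 om2.
have psq : p ^+ 2 <= ((q * k + xi) * M) ^+ 2.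
  by rewrite ler_sqr ?nnegrE // (le_trans perp0 perp).
apply: hT.
- apply: contraTneq om0 => w0; rewrite /om w0 /dot big1 ?ltxx // => j _.
  by rewrite !mxE mulr0.
- rewrite -ler_sqr ?nnegrE ?enorm_ge0 ?(ltW M0) // wsq.
  have osq : om ^+ 2 <= ((a + 4 * xi) * M) ^+ 2.
    by rewrite ler_sqr ?nnegrE ?(ltW om0) // (le_trans (ltW om0) om2).
  apply: le_trans (lerD osq psq) _; rewrite !exprMn -mulrDl.
  by rewrite ler_piMl ?sqr_ge0.
- rewrite -ler_sqr ?nnegrE ?mulr_ge0 ?enorm_ge0 ?(ltW om0) // exprMn wsq.
  have psq2 : p ^+ 2 <= s ^+ 2 * M ^+ 2.
    by apply: le_trans psq _; rewrite exprMn ler_wpM2r ?sqr_ge0 // ler_sqr ?nnegrE ?(ltW s0) // addr_ge0 ?mulr_ge0 // ltW.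
  have aM : (a * M) ^+ 2 <= om ^+ 2.
    rewrite ler_sqr ?nnegrE ?(ltW om0) ?mulr_ge0 ?(ltW M0) //.
    by apply: le_trans om1; rewrite ler_wpM2r ?(ltW M0) // lerDl ltW.
  have h1 : a ^+ 2 * p ^+ 2 <= a ^+ 2 * (s ^+ 2 * M ^+ 2) by rewrite ler_wpM2l ?sqr_ge0.
  have h2 : s ^+ 2 * (a * M) ^+ 2 <= s ^+ 2 * om ^+ 2 by rewrite ler_wpM2l ?sqr_ge0.
  rewrite exprMn in h2.
  rewrite mulrDr [leRHS](_ : _ = a ^+ 2 * om ^+ 2 + s ^+ 2 * om ^+ 2); last by rewrite -mulrDl as1 mul1r.
  by rewrite lerD2l (le_trans h1) // mulrCA.
Qed.

Lemma int_ball_seq d (M : R) : exists2 Y : seq 'rV[int]_d, uniq Y &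
  forall y, (y \in Y) = (enorm (emb y) <= M).
Proof.
pose N := (Num.truncn M).+1.
pose f (g : {ffun 'I_d -> 'I_(2 * N).+1}) : 'rV[int]_d := \row_j ((g j : nat)%:Z - N%:Z).
exists [seq y <- undup (codom f) | enorm (emb y) <= M].
  by rewrite filter_uniq // undup_uniq.
move=> y; rewrite mem_filter mem_undup; case: (boolP (_ <= M)) => //= yM.
apply/codomP; exists [ffun j => inord (absz (y 0 j + N%:Z))].
have hy j : `|y 0 j| <= N%:Z.
  have h : `|(y 0 j)%:~R| <= M by apply: le_trans (yM); have := entry_le_enorm (emb y) j; rewrite mxE.
  rewrite -(ler_int R) intr_norm; apply: le_trans h (ltW _).
  exact: truncnS_gt.
apply/rowP => j; rewrite !mxE ffunE inordK; have := hy j; lia.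
Qed.

Lemma count_classes (T : eqType) (Y : seq T) (B : pred T) (f : T -> nat) m :
  {in Y, forall y, (f y < m)%N} ->
  (count B Y <= \sum_(i < m) count (fun y => B y && (f y == i)) Y)%N.
Proof.
elim: Y => [|y Y IHY] // hf; rewrite (eq_bigr (fun i : 'I_m =>
  (B y && (f y == i)) + count (fun y => B y && (f y == i)) Y)%N) // big_split /=.
apply: leq_add; last by apply: IHY => x xY; apply: hf; rewrite inE xY orbT.
have fm : (f y < m)%N by apply: hf; rewrite inE eqxx.
by rewrite (bigD1 (Ordinal fm)) //= eqxx andbT leq_addr.
Qed.

Definition in_cone d (a : R) (e : 'rV[R]_d) (y : 'rV[int]_d) : bool :=
  a * enorm (emb y) <= dot e (emb y).

(** Compares a narrow cone, of angle with cosine [a] and sine [s], to a wide cone of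
    angle with cosine [b].  The number [q] bounds the sine of the angles met in
    the wide cone, so it also covers the case of a wide cone equal to the whole
    space, with [b = -1] and [q = 1].  The point 0 is counted in the wide cone
    only: it has no direction, so it cannot serve as a capturing centre. *)
Lemma cone_count (a s q : R) (u v : nat) :
  0 <= a -> 0 < s -> a ^+ 2 + s ^+ 2 = 1 -> 0 <= q -> (0 < v <= u)%N ->
  q * v%:R < s * u%:R ->
  exists m : nat, forall d, exists Y : seq 'rV[int]_d,
  forall (e : 'rV[R]_d) (b : R), dot e e = 1 ->
    (forall t, b <= t -> t <= 1 -> 1 - t ^+ 2 <= q ^+ 2) ->
    (0 < count (in_cone b e) Y)%N /\
    (count (in_cone b e) Y * v ^ d <=
     m * (count (fun y => (y != 0%R) && in_cone a e y) Y
          * u ^ d))%N.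
Proof.
move=> a0 s0 as1 q0 vu qs; case/andP: (vu) => v0 vu'.
have u0 : 0 < u%:R :> R by rewrite ltr0n (leq_trans v0).
have k0 : 0 <= q * v%:R / u%:R by rewrite divr_ge0 ?mulr_ge0 ?ler0n.
have ks : q * v%:R / u%:R < s by rewrite ltr_pdivrMr.
have s1 : s <= 1 by rewrite -(@expr_le1 _ 2) ?(ltW s0) //; have := sqr_ge0 a; lra.
have a1 : a <= 1 by rewrite -(@expr_le1 _ 2) //; have := sqr_ge0 s; lra.
have [xi [xi0 qx qa]] : exists xi, [/\ 0 < xi, q * v%:R / u%:R + xi <= s &
    (a + 4 * xi) ^+ 2 + (q * v%:R / u%:R + xi) ^+ 2 <= 1].
  move: (q * v%:R / u%:R) k0 ks => k k0 ks.
  have De0 : 0 < s - k by rewrite subr_gt0.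
  (* Expanding the squares, the terms in [xi] amount to at most [27 * xi], while
     the available slack is [s ^+ 2 - k ^+ 2 >= (s - k) * s]. *)
  exists ((s - k) * s / 27); split; first by rewrite divr_gt0 ?mulr_gt0.
    by have := ler_piMr (ltW De0) s1; lra.
  set xi := (s - k) * s / 27.
  have e27 : 27 * xi = (s - k) * s by rewrite /xi; field.
  have xi0 : 0 < xi by rewrite divr_gt0 ?mulr_gt0.
  have xi1 : xi <= 1 by have := ler_piMr (ltW De0) s1; rewrite -e27; lra.
  clearbody xi.
  have h1 : a * xi <= xi by rewrite ler_piMl // ltW.
  have h2 : xi * xi <= xi by rewrite ler_piMl ?(ltW xi0).
  have h3 : k * xi <= xi by rewrite ler_piMl ?(ltW xi0) //; lra.
  have h4 : k * k <= k * s by rewrite ler_wpM2l // ltW.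
  by rewrite -[leRHS]as1; lra.
pose m := (Num.truncn (2 / xi)).+1.
exists m => d.
pose M : R := (v%:R + 1) * d%:R / xi + 1.
have M0 : 0 < M by rewrite ltr_pwDr // divr_ge0 ?(ltW xi0) ?mulr_ge0 ?addr_ge0 ?ler0n.
have dM : (v%:R + 1) * d%:R <= xi * M.
  by rewrite /M mulrDr mulr1 [xi * _]mulrC divfK ?gt_eqF // lerDl ltW.
have [Y uY hY] := int_ball_seq d M.
exists Y => e b e1 hb; split.
  rewrite -has_count; apply/hasP; exists 0.
    rewrite hY enormE /dot big1 ?sqrtr0 ?(ltW M0) // => j _.
    by rewrite !mxE mul0r.
  rewrite /in_cone; have -> : emb (0 : 'rV[int]_d) = 0 by apply/rowP => j; rewrite !mxE.
  rewrite enormE /dot !big1 ?sqrtr0 ?mulr0 // => j _; by rewrite !mxE ?mulr0.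
set B := in_cone b e.
set A := (fun y => _ && _).
have en1 : enorm e = 1 by rewrite enormE e1 sqrtr1.
pose f (y : 'rV[int]_d) := Num.truncn ((dot e (emb y) + M) / (xi * M)).
have xM : 0 < xi * M by rewrite mulr_gt0.
have dotY y : y \in Y -> - M <= dot e (emb y) <= M.
  rewrite hY => yM; apply/andP; split.
    rewrite lerNl -mulN1r -dotZr scaleN1r; apply: le_trans (dot_le _ _) _.
    by rewrite en1 mul1r enormN.
  by apply: le_trans (dot_le _ _) _; rewrite en1 mul1r.
have fm : {in Y, forall y, (f y < m)%N}.
  move=> y /dotY /andP[_ h]; rewrite ltnS; apply: le_truncn.
  rewrite ler_pdivrMr // (_ : 2 / xi * _ = 2 * M); last first.
    by rewrite mulrA divfK ?gt_eqF.
  by lra.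
have hi (i : 'I_m) : (count (fun y => B y && (f y == i)) Y * v ^ d
    <= count A Y * u ^ d)%N.
  rewrite -!size_filter.
  apply: (slab_count (c := - M + i%:R * (xi * M)) vu a0 s0 as1 q0 xi0 qx qa M0 dM e1).
  - exact: filter_uniq.
  - move=> z; rewrite mem_filter => /andP[/andP[Bz /eqP fz] zY].
    have /andP[d1 d2] := dotY z zY.
    have x0 : 0 <= (dot e (emb z) + M) / (xi * M) by rewrite divr_ge0 ?(ltW xM) //; lra.
    have /andP[t1 t2] := truncn_itv x0; rewrite -/(f z) fz in t1 t2.
    split.
      rewrite ler_pdivlMr // in t1; rewrite ltr_pdivrMr // -addn1 natrD mulrDl in t2.
      by apply/andP; split; lra.
    rewrite hY in zY.
    have [z0|z0] := eqVneq (enorm (emb z)) 0.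
      rewrite z0 expr0n /=; have := sqr_ge0 (dot e (emb z)); have := sqr_ge0 (q * M); lra.
    have zp : 0 < enorm (emb z) by rewrite lt_def z0 enorm_ge0.
    have := hb (dot e (emb z) / enorm (emb z)).
    rewrite ler_pdivlMr // ler_pdivrMr // mul1r.
    have /[swap] /[apply] := Bz.
    have h1 : dot e (emb z) <= enorm (emb z).
      by apply: le_trans (dot_le _ _) _; rewrite en1 mul1r.
    move=> /(_ h1) h2; rewrite !exprMn.
    apply: (@le_trans _ _ (q ^+ 2 * enorm (emb z) ^+ 2)); last first.
      by rewrite ler_wpM2l ?sqr_ge0 // ler_sqr ?nnegrE ?enorm_ge0 ?(ltW M0).
    apply: le_trans (ler_wpM2r (sqr_ge0 _) h2).
    rewrite mulrBl mul1r exprMn exprVn divfK ?expf_neq0 ?gt_eqF //.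
  - move=> w w0 wM wA; by rewrite mem_filter /A w0 hY wM andbT; exact: wA.
apply: (@leq_trans ((\sum_(i < m) count (fun y => B y && (f y == i)) Y) * v ^ d)%N).
  by rewrite leq_mul2r count_classes ?orbT.
rewrite big_distrl /=; apply: (@leq_trans (\sum_(i < m) count A Y * u ^ d)%N).
  by apply: leq_sum => i _.
by rewrite sum_nat_const card_ord.
Qed.

End Cones.

(** * Colorings, nets and thin shells *)

Local Open Scope classical_set_scope.
Local Open Scope ring_scope.

Section Colourings.
Variables (R : realType) (d : nat).
Implicit Types (E : set 'rV[R]_d) (k : nat).

(** Colorings as total functions into [nat], which makes unions of sets easy. *)
Definition colorable E k : Prop := exists c : 'rV[R]_d -> nat,
  (forall x, E x -> (c x < k)%N) /\
  (forall x y, E x -> E y -> enorm (x - y) = 1 -> c x <> c y).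

Lemma colorable_unit_colorable E k : colorable E k -> unit_colorable E k.
Proof.
move=> [c [ck cE]]; have hE (u : E) : E (val u) by exact: set_mem (valP u).
exists (fun u => Ordinal (ck _ (hE u))) => u v uv /(congr1 val) /= h.
exact: (cE _ _ (hE u) (hE v) uv h).
Qed.

Lemma colorableS E1 E2 k : E1 `<=` E2 -> colorable E2 k -> colorable E1 k.
Proof.
by move=> s [c [ck cE]]; exists c; split=> [x /s/ck|x y /s ? /s] //; apply: cE.
Qed.

Lemma colorableU E1 E2 k1 k2 : colorable E1 k1 -> colorable E2 k2 ->
  colorable (E1 `|` E2) (k1 + k2).
Proof.
move=> [c1 [ck1 cE1]] [c2 [ck2 cE2]].
exists (fun x => if `[< E1 x >] then c1 x else k1 + c2 x)%N; split.
  move=> x Ex; case: asboolP => [/ck1 h|nE]; first exact: ltn_addr.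
  by case: Ex => // /ck2; rewrite ltn_add2l.
move=> x y Ex Ey xy; case: asboolP => [Ex1|nEx]; case: asboolP => [Ey1|nEy].
- exact: cE1.
- by move=> e; have := ck1 x Ex1; rewrite e -ltn_subRL subnn.
- by move=> e; have := ck1 y Ey1; rewrite -e -ltn_subRL subnn.
- by move=> /addnI; apply: cE2 => //; [case: Ex | case: Ey].
Qed.

End Colourings.

Section Shells.
Variable R : realType.

(** The sets [E d] can be colored with [O(d ^ 2 * (u / v) ^ d)] colors.  The base
    is a fraction because the lattice count contracts by rational ratios. *)
Definition color_growth (u v : nat) (E : forall d, set 'rV[R]_d) : Prop :=
  exists K : nat, forall n, exists2 k, colorable (E n.+1) k &
    (k * v ^ n.+1 <= K * n.+1 ^ 2 * u ^ n.+1)%N.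

(** The net consists of one point of [E] in each cell, meeting [E], of a cubic grid
    of side [delta / d], so that its points satisfy the same norm constraints as
    those of [E].  Its cardinal is [exp (O (d * log d))]. *)
Lemma cell_net (r delta : R) : 0 < delta -> exists W : nat,
  forall n (E : set 'rV[R]_n.+1), E !=set0 -> (forall x, E x -> enorm x <= r) ->
  exists (I : finType) (p : I -> 'rV[R]_n.+1) (g : 'rV[R]_n.+1 -> I),
    [/\ #|I| = ((n.+1 * W).+1 ^ n.+1)%N, forall i, E (p i) &
        forall x, E x -> enorm (x - p (g x)) <= delta].
Proof.
move=> d0; exists (Num.truncn (2 * r / delta)).+1 => n E [x0 Ex0] hE.
set W := (Num.truncn (2 * r / delta)).+1; set L := n.+1%:R / delta.
have L0 : 0 < L by rewrite divr_gt0 ?ltr0n.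
pose I := {ffun 'I_n.+1 -> 'I_(n.+1 * W).+1}.
pose g (x : 'rV[R]_n.+1) : I := [ffun j => inord (Num.truncn ((x 0 j + r) * L))].
pose p i := xget x0 [set x | E x /\ g x = i].
exists I, p, g; split.
- by rewrite card_ffun !card_ord.
- by move=> i; rewrite /p; case: xgetP => [x _ []|].
move=> x Ex; have [Ep gp] : E (p (g x)) /\ g (p (g x)) = g x.
  exact: (@xgetPex _ x0 [set y | E y /\ g y = g x]) (ex_intro _ x (conj Ex erefl)).
have cell y j : E y -> (g y j : nat)%:R <= (y 0 j + r) * L < (g y j : nat).+1%:R.
  move=> Ey; have := entry_le_enorm y j; rewrite ler_norml => /andP[h1 h2].
  have hr := hE y Ey.
  have pos : 0 <= (y 0 j + r) * L by rewrite mulr_ge0 ?(ltW L0) //; lra.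
  rewrite ffunE inordK ?truncn_itv // ltnS ltnW // truncn_lt_nat //.
  apply: (@le_lt_trans _ _ (2 * r * L)); first by rewrite ler_wpM2r ?(ltW L0) //; lra.
  rewrite /L natrM mulrCA ltr_pM2l ?ltr0n // /W.
  exact: truncnS_gt.
have -> : delta = L^-1 * n.+1%:R by rewrite /L invf_div divfK // pnatr_eq0.
apply: enorm_le_entries; last by rewrite invr_ge0 ltW.
move=> j; rewrite !mxE -(ler_pM2r L0) mulVf ?gt_eqF // -[X in _ * X]gtr0_norm // -normrM.
have := cell x j Ex; have := cell _ j Ep; rewrite gp => /andP[h1 h2] /andP[h3 h4].
by rewrite -(addn1 (g x j : nat)) natrD in h2 h4; rewrite ler_norml; apply/andP; split; lra.
Qed.

Lemma enorm_emb_gt0 d (y : 'rV[int]_d) : y != 0 -> 0 < enorm (emb R y).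
Proof.
move=> y0; have [j yj] : exists j, y 0 j != 0.
  by move/eqP: y0 => y0; apply/existsP; apply: contraT => /existsPn h; case: y0;
    apply/rowP => j; have /negPn/eqP := h j; rewrite mxE.
apply: lt_le_trans (entry_le_enorm _ j); rewrite mxE normr_gt0 intr_eq0 //.
Qed.

Definition shell (s delta : R) d : set 'rV[R]_d :=
  [set x | s <= enorm x <= s + delta].

Lemma unit_dot_le1 d (x y : 'rV[R]_d) :
  dot x x = 1 -> dot y y = 1 -> -1 <= dot x y <= 1.
Proof.
move=> x1 y1; rewrite -ler_norml -(@expr_le1 _ 2) ?normr_ge0 //.
by rewrite real_normK ?num_real // (le_trans (cauchy_schwarz _ _)) // x1 y1 mulr1.
Qed.

Lemma sqr_le_lower (x c : R) : 0 <= c -> x ^+ 2 <= c ^+ 2 -> - c <= x.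
Proof.
move=> c0; rewrite -[x ^+ 2]real_normK ?num_real // ler_sqr ?nnegrE //.
by rewrite ler_norml => /andP[].
Qed.

(** Two points within angle [alpha] of a third one are within angle [2 * alpha]. *)
Lemma cap_close d (a : R) (x y z : 'rV[R]_d) : 0 <= a ->
  dot x x = 1 -> dot y y = 1 -> dot z z = 1 ->
  a <= dot x z -> a <= dot y z -> 2 * a ^+ 2 - 1 <= dot x y.
Proof.
move=> a0 x1 y1 z1 ax ay; have := gram3 x1 y1 z1.
have /andP[_ x2] := unit_dot_le1 x1 z1; have /andP[_ y2] := unit_dot_le1 y1 z1.
set t := dot x z in ax x2 *; set t' := dot y z in ay y2 *; move=> h.
have t0 : 0 <= t by lra. have t'0 : 0 <= t' by lra.
have ht : a ^+ 2 <= t ^+ 2 <= 1 by rewrite ler_sqr ?nnegrE // ax exprn_ile1.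
have ht' : a ^+ 2 <= t' ^+ 2 <= 1 by rewrite ler_sqr ?nnegrE // ay exprn_ile1.
case/andP: ht => ht1 ht2; case/andP: ht' => ht1' ht2'.
have : - (1 - a ^+ 2) <= dot x y - t * t'.
  apply: sqr_le_lower; first lra.
  by apply: le_trans h _; rewrite expr2 ler_pM //; lra.
have : a * a <= t * t' by rewrite ler_pM.
by rewrite expr2; lra.
Qed.

(** If [z] is within angle [gamma] of [x] and [y] within [2 * gamma], then [y] is within
    [3 * gamma] of [z]; the bound is [cos (3 * gamma)] as a polynomial in the cosine
    [g].  The hypothesis [1 <= 2 * g ^+ 2] keeps [cos (2 * gamma)] nonnegative, so
    that the products of cosines can be bounded below. *)
Lemma cap_triple d (g : R) (x y z : 'rV[R]_d) : 0 <= g -> 1 <= 2 * g ^+ 2 ->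
  dot x x = 1 -> dot y y = 1 -> dot z z = 1 ->
  g <= dot z x -> 2 * g ^+ 2 - 1 <= dot y x -> 4 * g ^+ 3 - 3 * g <= dot y z.
Proof.
move=> g0 g2 x1 y1 z1 gz gy; have := gram3 y1 z1 x1.
have /andP[_ z2] := unit_dot_le1 z1 x1; have /andP[_ y2] := unit_dot_le1 y1 x1.
set t := dot z x in gz z2 *; set r := dot y x in gy y2 *; move=> h.
set c := 2 * g ^+ 2 - 1 in gy *; have c0 : 0 <= c by rewrite /c; lra.
have t0 : 0 <= t by lra. have r0 : 0 <= r by lra.
have /andP[ht1 ht2] : g ^+ 2 <= t ^+ 2 <= 1 by rewrite ler_sqr ?nnegrE // gz exprn_ile1.
have /andP[hr1 hr2] : c ^+ 2 <= r ^+ 2 <= 1 by rewrite ler_sqr ?nnegrE // gy exprn_ile1.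
have gr : c * g <= r * t by rewrite ler_pM.
have : - (2 * g * (1 - g ^+ 2)) <= dot y z - r * t.
  apply: sqr_le_lower; first by rewrite !mulr_ge0 //; lra.
  apply: le_trans h _.
  rewrite (_ : (2 * g * _) ^+ 2 = (1 - c ^+ 2) * (1 - g ^+ 2)); last by rewrite /c; ring.
  by rewrite ler_pM //; lra.
have -> : 4 * g ^+ 3 - 3 * g = c * g - 2 * g * (1 - g ^+ 2) by rewrite /c; ring.
lra.
Qed.

Definition dir d (x : 'rV[R]_d) : 'rV[R]_d := (enorm x)^-1 *: x.

Lemma dot_dir d (x : 'rV[R]_d) : 0 < enorm x -> dot (dir x) (dir x) = 1.
Proof.
move=> x0; rewrite dotZl dotZr -sqr_enorm expr2.
by rewrite mulKf ?gt_eqF // mulVf ?gt_eqF.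
Qed.

Lemma dot_dirr d (e x : 'rV[R]_d) c : 0 < enorm x ->
  (c <= dot e (dir x)) = (c * enorm x <= dot e x).
Proof. by move=> x0; rewrite dotZr mulrC ler_pdivlMr. Qed.

Lemma shell_dir d (s delta : R) (x : 'rV[R]_d) : 0 < s -> shell s delta x ->
  enorm (x - s *: dir x) <= delta.
Proof.
move=> s0 /andP[h1 h2]; have x0 : 0 < enorm x by apply: lt_le_trans h1.
rewrite scalerA -{1}[x]scale1r -scalerBl enormZ -{2}[enorm x]gtr0_norm // -normrM.
by rewrite mulrBl mul1r divfK ?gt_eqF // ger0_norm ?subr_ge0 // lerBlDl.
Qed.

(** Projecting a shell radially onto its inner sphere moves points by at most
    [delta].  The net introduces the error [2 * delta] in distances. *)
Lemma shell_angle d (s delta : R) (x y : 'rV[R]_d) : 0 < s -> 4 * delta < 1 ->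
  shell s delta x -> shell s delta y ->
  1 - 2 * delta <= enorm (x - y) <= 1 + 2 * delta ->
  (1 - 4 * delta) ^+ 2 <= s ^+ 2 * (2 - 2 * dot (dir x) (dir y))
    <= (1 + 4 * delta) ^+ 2.
Proof.
move=> s0 d1 hx hy /andP[l1 l2].
have x0 : 0 < enorm x by case/andP: hx => h _; apply: lt_le_trans h.
have y0 : 0 < enorm y by case/andP: hy => h _; apply: lt_le_trans h.
rewrite -sqr_enormB ?dot_dir // -exprMn.
have -> : s * enorm (dir x - dir y) = enorm (s *: dir x - s *: dir y).
  by rewrite -scalerBr enormZ gtr0_norm.
have hi := shell_dir s0 hx; have hj := shell_dir s0 hy.
have t1 := enormB_le (s *: dir x) x (s *: dir y).
have t2 := enormB_le x y (s *: dir y).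
have t3 := enormB_le x (s *: dir x) y.
have t4 := enormB_le (s *: dir x) (s *: dir y) y.
rewrite (enorm_distC _ x) in t1; rewrite (enorm_distC (s *: dir y) y) in t4.
move: hi hj t1 t2 t3 t4 (enorm_ge0 (s *: dir x - s *: dir y)) l1 l2.
move: (enorm (_ - _)) (enorm (_ - _)) (enorm (_ - _)) (enorm (_ - _)) (enorm (_ - _)) (enorm (_ - _)).
clear -d1 => A B C D F G *.
have [d0|d0] := ltP delta 0; first lra.
by apply/andP; split; rewrite ler_sqr ?nnegrE //; lra.
Qed.

Lemma captured_pair d (s delta eps a si : R) (x y z : 'rV[R]_d) :
  0 < s -> 4 * delta < eps -> 0 <= a -> 0 < si -> a ^+ 2 + si ^+ 2 = 1 ->
  2 * s * si = 1 - eps -> shell s delta x -> shell s delta y -> 0 < enorm z ->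
  a * enorm z <= dot (dir x) z -> a * enorm z <= dot (dir y) z ->
  ~~ (1 - 2 * delta <= enorm (x - y) <= 1 + 2 * delta).
Proof.
move=> s0 de4 a0 si0 asi ssi hx hy z0; rewrite -!dot_dirr // => ax ay.
have eps1 : 0 < 1 - eps by rewrite -ssi !mulr_gt0.
apply/negP => hxy; have d1 : 4 * delta < 1 by lra.
have /andP[c1 _] := shell_angle s0 d1 hx hy hxy.
have x0 : 0 < enorm x by case/andP: hx => h _; apply: lt_le_trans h.
have y0 : 0 < enorm y by case/andP: hy => h _; apply: lt_le_trans h.
have h := cap_close a0 (dot_dir x0) (dot_dir y0) (dot_dir z0) ax ay.
have : (1 - eps) ^+ 2 < (1 - 4 * delta) ^+ 2 by rewrite ltr_sqr ?nnegrE; lra.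
apply/negP; rewrite -leNgt; apply: le_trans c1 _.
rewrite -ssi (_ : (2 * s * si) ^+ 2 = s ^+ 2 * (4 * si ^+ 2)); last by ring.
by rewrite ler_wpM2l ?sqr_ge0 //; lra.
Qed.

Lemma unaffected_pair d (s delta eps a b : R) (x y z : 'rV[R]_d) :
  0 < s -> 0 < delta -> 4 * delta < eps -> eps < 1 ->
  (forall x y z : 'rV[R]_d, dot x x = 1 -> dot y y = 1 -> dot z z = 1 ->
     a <= dot x z -> dot y z < b -> (1 + eps) ^+ 2 <= s ^+ 2 * (2 - 2 * dot x y)) ->
  shell s delta x -> shell s delta y -> 0 < enorm z ->
  a * enorm z <= dot (dir x) z -> ~~ (b * enorm z <= dot (dir y) z) ->
  ~~ (1 - 2 * delta <= enorm (x - y) <= 1 + 2 * delta).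
Proof.
move=> s0 de0 de4 ep1 excl hx hy z0; rewrite -!dot_dirr // -ltNge => ax by_.
apply/negP => hxy; have d1 : 4 * delta < 1 by lra.
have /andP[_ c2] := shell_angle s0 d1 hx hy hxy.
have x0 : 0 < enorm x by case/andP: hx => h _; apply: lt_le_trans h.
have y0 : 0 < enorm y by case/andP: hy => h _; apply: lt_le_trans h.
have h := excl _ _ _ (dot_dir x0) (dot_dir y0) (dot_dir z0) ax by_.
have : (1 + 4 * delta) ^+ 2 < (1 + eps) ^+ 2 by rewrite ltr_sqr ?nnegrE; lra.
by rewrite ltNge (le_trans h c2).
Qed.

(** The coloring scheme for one shell.  Here [si] is the sine of the capture angle
    and [a] its cosine, [b] is the cosine of the exclusion angle, [q] bounds the
    sines of the angles up to it, and the last hypothesis on [b] states that the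
    exclusion angle exceeds the capture angle by enough. *)
Lemma shell_coloring (s delta eps a si q b : R) (u v : nat) :
  0 < s -> 0 < delta -> 4 * delta < eps ->
  0 <= a -> 0 < si -> a ^+ 2 + si ^+ 2 = 1 -> 2 * s * si = 1 - eps ->
  0 <= q -> b <= a -> (forall t, b <= t -> t <= 1 -> 1 - t ^+ 2 <= q ^+ 2) ->
  (forall d (x y z : 'rV[R]_d), dot x x = 1 -> dot y y = 1 -> dot z z = 1 ->
     a <= dot x z -> dot y z < b -> (1 + eps) ^+ 2 <= s ^+ 2 * (2 - 2 * dot x y)) ->
  (0 < v <= u)%N -> q * v%:R < si * u%:R ->
  color_growth u v (fun d => @shell s delta d).
Proof.
move=> s0 de0 de4 a0 si0 asi ssi q0 ba bq excl vu qvu.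
have ep1 : eps < 1 by rewrite -subr_gt0 -ssi !mulr_gt0.
have [m hm] := cone_count a0 si0 asi q0 vu qvu.
have [W hW] := cell_net (s + delta) de0.
exists (m.+1 * W.+1)%N => n.
have [[x0 Ex0]|E0] := pselect (shell s delta (d := n.+1) !=set0); last first.
  exists 0%N => //; exists (fun=> 0%N).
  by split=> [x Ex|x y Ex]; case: E0; exists x.
have [I [p [g [cI pE gE]]]] :=
  hW n _ (ex_intro _ x0 Ex0) (fun x (h : shell s delta x) => proj2 (andP h)).
have [Y hY] := hm n.+1.
have p0 i : 0 < enorm (p i) by case/andP: (pE i) => h _; apply: lt_le_trans h.
pose A (y : 'rV[int]_n.+1) i := (y != 0) && in_cone a (dir (p i)) y.
pose B (y : 'rV[int]_n.+1) i := in_cone b (dir (p i)) y.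
have AB y i : A y i -> B y i.
  by move=> /andP[_]; apply: le_trans; rewrite ler_wpM2r ?enorm_ge0.
pose C := ((m * u ^ n.+1) %/ v ^ n.+1).+1.
case/andP: (vu) => v0 vu'.
have vd : (0 < v ^ n.+1)%N by rewrite expn_gt0 v0.
have hC i : (0 < count (B^~ i) Y <= C * count (A^~ i) Y)%N.
  have [h1 h2] := hY _ b (dot_dir (p0 i)) bq; rewrite h1 /=.
  rewrite -(leq_pmul2r vd); apply: leq_trans h2 _.
  have h := ltn_ceil (m * u ^ n.+1) vd.
  by rewrite mulnCA (mulnC C) -mulnA leq_mul2l (ltnW h) orbT.
pose G i j := exists y, [\/ A y i /\ A y j, A y i /\ ~~ B y j | A y j /\ ~~ B y i].
pose mm := ((n.+1 * W).+1 * n.+1)%N.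
have hI : (#|I| < 2 ^ mm)%N by rewrite cI expnM ltn_exp2r // ltn_expl.
have hG (F : {set I}) : exists Phi : {set I}, [/\ Phi \subset F,
    (#|F| <= C * #|Phi|)%N & forall i j, i \in Phi -> j \in Phi -> G i j].
  exact: (capture (Y := Y) AB (fun i _ => hC i)).
have [c [cC cG]] := greedy_cover hG hI.
exists (C * mm)%N; last first.
  have h1 : (C * v ^ n.+1 <= m.+1 * u ^ n.+1)%N.
    rewrite /C mulSn mulSn leq_add ?leq_trunc_div //.
    by rewrite leq_exp2r.
  have h2 : (mm <= W.+1 * n.+1 ^ 2)%N.
    rewrite /mm -mulnn mulnA leq_mul2r.
    by rewrite [(W.+1 * _)%N]mulSn (mulnC W) -[X in (X <= _)%N]add1n leq_add2r orbT.
  rewrite mulnAC (leq_trans (leq_mul h1 h2)) //.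
  by rewrite leq_eqVlt; apply/orP; left; apply/eqP; ring.
have G_far i j : G i j -> ~~ (1 - 2 * delta <= enorm (p i - p j) <= 1 + 2 * delta).
  have excl' := excl n.+1.
  case=> y [] [/andP[/enorm_emb_gt0 y0 Ai]].
  - by move=> /andP[_ Aj]; apply: captured_pair (pE i) (pE j) y0 Ai Aj; eassumption.
  - by move=> Bj; apply: unaffected_pair excl' (pE i) (pE j) y0 Ai Bj; eassumption.
  - move=> Bi; rewrite enorm_distC.
    by apply: unaffected_pair excl' (pE j) (pE i) y0 Ai Bi; eassumption.
exists (fun x => c (g x)); split=> [x _|x y Ex Ey xy /cG /G_far]; first exact: cC.
apply/negP; rewrite negbK.
have h1 := gE _ Ex; have h2 := gE _ Ey.
have t1 := enormB_le x (p (g x)) y; have t2 := enormB_le (p (g x)) (p (g y)) y.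
have t3 := enormB_le (p (g x)) x (p (g y)); have t4 := enormB_le x y (p (g y)).
rewrite (enorm_distC (p (g y)) y) in t2; rewrite (enorm_distC (p (g x)) x) in t3.
move: h1 h2 t1 t2 t3 t4; rewrite xy.
move: (enorm _) (enorm _) (enorm _) (enorm _) (enorm _); clear => P Q S T U *.
by apply/andP; split; lra.
Qed.

(** Every centre affects all points, so that each color class is part of one
    cap. *)
Lemma shell_small (s delta eps : R) (u v : nat) :
  1 / 2 <= s -> 0 < delta -> 4 * delta < eps -> eps < 1 -> (0 < v <= u)%N ->
  2 * s * v%:R < (1 - eps) * u%:R ->
  color_growth u v (fun d => @shell s delta d).
Proof.
move=> s2 de0 de4 ep1 vu h; have s0 : 0 < s by lra.
set si := (1 - eps) / (2 * s).
have ssi : 2 * s * si = 1 - eps by rewrite /si mulrC divfK // gt_eqF ?mulr_gt0.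
have si0 : 0 < si by rewrite divr_gt0 ?mulr_gt0 ?subr_gt0.
have si1 : si ^+ 2 <= 1.
  by rewrite expr_le1 ?(ltW si0) // ler_pdivrMr ?mulr_gt0 //; lra.
apply: (@shell_coloring s delta eps (Num.sqrt (1 - si ^+ 2)) si 1 (-1)) => //.
- by rewrite sqr_sqrtr ?subrK // subr_ge0.
- by rewrite (le_trans _ (sqrtr_ge0 _)) // lerN10.
- by move=> t _ _; rewrite expr1n lerBlDr lerDl sqr_ge0.
- move=> d x y z _ y1 z1 _; have /andP[h1 _] := unit_dot_le1 y1 z1.
  by rewrite ltNge h1.
- by rewrite mul1r /si mulrAC ltr_pdivlMr ?mulr_gt0 // mulrC.
Qed.

(** With [h = sin gamma = (1 + eps) / (2 * s)], the exclusion angle is [3 * gamma]; the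
    hypothesis [1 + eps <= s] gives [gamma <= pi / 6], so that it is at most a right
    angle and [q = sin (3 * gamma) = h * (3 - 4 * h ^+ 2)]. *)
Lemma shell_large (s delta eps : R) (u v : nat) :
  1 + eps <= s -> 0 < delta -> 4 * delta < eps -> eps < 1 -> (0 < v <= u)%N ->
  (1 + eps) * (3 - 1 / s ^+ 2) * v%:R < (1 - eps) * u%:R ->
  color_growth u v (fun d => @shell s delta d).
Proof.
move=> s2 de0 de4 ep1 vu hr; have s0 : 0 < s by lra. have ep0 : 0 < eps by lra.
set si := (1 - eps) / (2 * s); set h := (1 + eps) / (2 * s).
have ssi : 2 * s * si = 1 - eps by rewrite /si mulrC divfK // gt_eqF ?mulr_gt0.
have sh : 2 * s * h = 1 + eps by rewrite /h mulrC divfK // gt_eqF ?mulr_gt0.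
have si0 : 0 < si by rewrite divr_gt0 ?mulr_gt0 ?subr_gt0.
have h0 : 0 < h by rewrite divr_gt0 ?mulr_gt0 ?addr_gt0.
have sih : si <= h by rewrite ler_pM2r ?invr_gt0 ?mulr_gt0 //; lra.
have h12 : h <= 1 / 2 by rewrite ler_pdivrMr ?mulr_gt0 //; lra.
have h22 : h ^+ 2 <= 1 / 4 by rewrite expr2; nra.
have sih2 : si ^+ 2 <= h ^+ 2 by rewrite ler_sqr ?nnegrE ?(ltW si0) ?(ltW h0).
have hs : 1 / s ^+ 2 <= 4 * h ^+ 2.
  rewrite ler_pdivrMr ?exprn_gt0 // (_ : 4 * h ^+ 2 * s ^+ 2 = (2 * s * h) ^+ 2); last by ring.
  by rewrite sh expr2; nra.
set g := Num.sqrt (1 - h ^+ 2).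
have g0 : 0 <= g by exact: sqrtr_ge0.
have g2 : g ^+ 2 = 1 - h ^+ 2 by rewrite sqr_sqrtr //; lra.
set b := 4 * g ^+ 3 - 3 * g.
have bE : b = g * (1 - 4 * h ^+ 2).
  by rewrite /b (_ : 4 * g ^+ 3 - 3 * g = g * (4 * g ^+ 2 - 3)); [rewrite g2; ring | ring].
have b0 : 0 <= b by rewrite bE mulr_ge0 //; lra.
have ga : g <= Num.sqrt (1 - si ^+ 2) by rewrite ler_wsqrtr //; lra.
apply: (@shell_coloring s delta eps (Num.sqrt (1 - si ^+ 2)) si (h * (3 - 4 * h ^+ 2)) b) => //.
- by rewrite sqr_sqrtr ?subrK //; lra.
- by rewrite mulr_ge0 ?(ltW h0) //; lra.
- apply: le_trans ga; rewrite bE ler_piMr //; have := sqr_ge0 h; lra.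
- move=> t bt _; have bt2 : b ^+ 2 <= t ^+ 2.
    by rewrite ler_sqr ?nnegrE // (le_trans b0).
  have : b ^+ 2 + (h * (3 - 4 * h ^+ 2)) ^+ 2 = 1 by rewrite bE exprMn g2; ring.
  lra.
- move=> d x y z x1 y1 z1 ax yb; rewrite -sh leNgt; apply/negP => lt.
  have gx : g <= dot z x by rewrite dotC (le_trans ga).
  have : 2 * g ^+ 2 - 1 <= dot y x.
    rewrite (_ : (2 * s * h) ^+ 2 = s ^+ 2 * (4 * h ^+ 2)) in lt; last by ring.
    by rewrite ltr_pM2l ?exprn_gt0 // in lt; rewrite g2 dotC; lra.
  move=> /(cap_triple g0 _ x1 y1 z1 gx); rewrite g2 => /(_ _); rewrite -/b.
  by move=> H; have := H ltac:(lra); lra.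
- have -> : h * (3 - 4 * h ^+ 2) = (1 + eps) * (3 - 4 * h ^+ 2) / (2 * s) by rewrite /h; ring.
  rewrite /si [X in X < _]mulrAC [X in _ < X]mulrAC ltr_pM2r ?invr_gt0 ?mulr_gt0 //.
  apply: le_lt_trans hr; rewrite ler_wpM2r ?ler0n // ler_wpM2l //; lra.
Qed.

End Shells.

(** * From shells to balls *)

Section Balls.
Variable R : realType.
Implicit Types (r s : R).

Lemma color_growthS u v (E1 E2 : forall d, set 'rV[R]_d) :
  (forall d, E1 d `<=` E2 d) -> color_growth u v E2 -> color_growth u v E1.
Proof.
by move=> s [K hK]; exists K => n; have [k /(colorableS (s _))] := hK n; exists k.
Qed.

Lemma color_growthU u v (E1 E2 : forall d, set 'rV[R]_d) :
  color_growth u v E1 -> color_growth u v E2 -> color_growth u v (fun d => E1 d `|` E2 d).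
Proof.
move=> [K1 h1] [K2 h2]; exists (K1 + K2)%N => n.
have [k1 c1 l1] := h1 n; have [k2 c2 l2] := h2 n.
by exists (k1 + k2)%N; [exact: colorableU | rewrite !mulnDl leq_add].
Qed.

(** For [r <= sqrt 5 / 2] this follows from [(s - 1) ^+ 2 * (2 * s + 1) >= 0].  For larger
    [r], with [v = 1 / r ^+ 2 < 4 / 5], the inequality [3 - v <= xbase r] becomes, after
    squaring twice, [0 <= v * (12 - 20 * v + 8 * v ^+ 2 - v ^+ 3)]. *)
Lemma xbase_large r s : 1 <= s -> s <= r -> 3 - 1 / s ^+ 2 <= xbase r.
Proof.
move=> s1 sr; have s0 : 0 < s by lra. have r0 : 0 < r by lra.
rewrite /xbase; case: ltP => hr; last first.
  have h : 3 - 1 / s ^+ 2 <= 2 * s; last by lra.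
  rewrite -(ler_pM2r (exprn_gt0 2 s0)) mulrBl divfK ?gt_eqF ?exprn_gt0 //.
  have : 0 <= (s - 1) ^+ 2 * (2 * s + 1) by rewrite mulr_ge0 ?sqr_ge0 //; lra.
  lra.
have r2 : 5 / 4 < r ^+ 2.
  have s5 : 0 <= Num.sqrt 5 / 2 :> R by rewrite divr_ge0 ?sqrtr_ge0.
  have : (Num.sqrt 5 / 2) ^+ 2 < r ^+ 2 by rewrite ltr_sqr ?nnegrE ?(ltW r0).
  by rewrite exprMn exprVn sqr_sqrtr //; lra.
pose v := 1 / r ^+ 2.
have v0 : 0 < v by rewrite divr_gt0 ?exprn_gt0.
have v1 : v < 4 / 5 by rewrite ltr_pdivrMr ?exprn_gt0 //; lra.
have vs : v <= 1 / s ^+ 2.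
  by rewrite ler_pM2l // lef_pV2 ?posrE ?exprn_gt0 // ler_sqr ?nnegrE ?(ltW r0) ?(ltW s0).
apply: (@le_trans _ _ (3 - v)); first by lra.
have -> : 2 / r ^+ 2 = 2 * v by rewrite /v; field; rewrite gt_eqF.
have -> : (5 * r ^+ 2 - 1) / (4 * r ^+ 4) = 5 * v / 4 - v ^+ 2 / 4.
  by rewrite /v; field; rewrite gt_eqF.
clearbody v.
have hD : (2 - v) ^+ 2 / 4 <= Num.sqrt (1 - (5 * v / 4 - v ^+ 2 / 4)).
  rewrite -[leLHS]ger0_norm ?divr_ge0 ?sqr_ge0 // -sqrtr_sqr ler_wsqrtr //.
  have : 0 <= v * (12 - 20 * v + 8 * v ^+ 2 - v ^+ 3) by rewrite mulr_ge0 ?(ltW v0) //; nra.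
  lra.
rewrite -[leLHS]ger0_norm -?sqrtr_sqr ?ler_wsqrtr //; last by lra.
by move: hD; rewrite !expr2; lra.
Qed.

Lemma xbase_small r s : s <= 1 -> s <= r -> 2 * s <= xbase r.
Proof.
move=> s1 sr; have [r1|r1] := leP 1 r.
  by have := xbase_large (lexx 1) r1; rewrite expr1n; lra.
rewrite /xbase; case: ltP => hr; last by lra.
have : (1 : R) <= Num.sqrt 5 / 2.
  rewrite ler_pdivlMr // mul1r -[leLHS]ger0_norm // -sqrtr_sqr ler_wsqrtr //; lra.
lra.
Qed.

(** Only finitely many shells, independently of the dimension, are needed, and
    the strict inequality leaves room to choose their thickness. *)
Lemma ball_color_growth r (u v : nat) : 1 / 2 < r -> (0 < v)%N ->
  xbase r * v%:R < u%:R -> color_growth u v (fun d => @eball R d r).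
Proof.
move=> r2 v0 huv.
have vR : 0 < v%:R :> R by rewrite ltr0n.
have X1 : 1 <= xbase r by have := @xbase_small r (1 / 2) ltac:(lra) (ltW r2); lra.
have vu : (0 < v <= u)%N.
  rewrite v0 -(ler_nat R) ltW // (le_lt_trans _ huv) // ler_peMl //; lra.
have [eps [ep0 ep1 hep]] : exists eps : R, [/\ 0 < eps, eps < 1 &
    (1 + eps) * (xbase r * v%:R) < (1 - eps) * u%:R].
  have Xv : 0 < xbase r * v%:R by rewrite mulr_gt0 //; lra.
  move: (xbase r * v%:R) Xv huv => w w0 wu; have u0 := lt_trans w0 wu.
  exists ((u%:R - w) / (2 * (u%:R + w))).
  have den : 0 < 2 * (u%:R + w) by lra.
  have e : (u%:R - w) / (2 * (u%:R + w)) * (2 * (u%:R + w)) = u%:R - w.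
    by rewrite divfK ?gt_eqF.
  split; first by rewrite divr_gt0 // subr_gt0.
    by rewrite ltr_pdivrMr //; lra.
  by move: e; move: ((u%:R - w) / _) => e; lra.
have hshell s : 1 / 2 <= s -> s <= r -> color_growth u v (fun d => @shell R s (eps / 5) d).
  move=> s2 sr; have [s1|s1] := ltP s (1 + eps).
    apply: (@shell_small _ s _ eps); rewrite ?divr_gt0 //; first by lra.
    apply: le_lt_trans hep; rewrite mulrA ler_wpM2r ?(ltW vR) //.
    have [s1'|s1'] := leP s 1.
      by have := xbase_small s1' sr; nra.
    have := @xbase_small r 1 (lexx 1) ltac:(lra); nra.
  apply: (@shell_large _ s _ eps); rewrite ?divr_gt0 //; first by lra.
  apply: le_lt_trans hep; rewrite [leRHS]mulrA ler_wpM2r ?(ltW vR) // ler_wpM2l //; first by lra.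
  by apply: xbase_large => //; lra.
have hJ (J : nat) : color_growth u v (fun d =>
    [set x : 'rV[R]_d | enorm x <= r /\ enorm x < 1 / 2 + J%:R * (eps / 5)]).
  elim: J => [|J IHJ].
    exists 1%N => n; exists 1%N.
      exists (fun=> 0%N); split=> // x y [_ hx] [_ hy] xy.
      exfalso; have := enormB_le x 0 y; rewrite subr0 sub0r enormN xy.
      by rewrite mul0r addr0 in hx hy; lra.
    by apply: leq_mul => //; rewrite leq_exp2r //; case/andP: vu.
  have [sr|sr] := leP (1 / 2 + J%:R * (eps / 5)) r; last first.
    by apply: color_growthS IHJ => d x /= [h1 h2]; split=> //; apply: le_lt_trans sr.
  apply: color_growthS (color_growthU IHJ (hshell _ _ sr)).
    move=> d x /= [h1 h2]; have [h|h] := ltP (enorm x) (1 / 2 + J%:R * (eps / 5)).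
      by left.
    by right; rewrite /shell /= h /=; move: h2; rewrite -natr1; lra.
  by rewrite lerDl mulr_ge0 ?ler0n ?divr_ge0 ?(ltW ep0).
apply: color_growthS (hJ (Num.truncn (r / (eps / 5))).+1) => d x /= xr; split=> //.
apply: le_lt_trans xr _; have := truncnS_gt (r / (eps / 5)).
by rewrite ltr_pdivrMr ?divr_gt0 //; lra.
Qed.

Lemma bernoulli (t : R) n : 0 <= t -> n%:R * t <= (1 + t) ^+ n.
Proof.
move=> t0; suff : 1 + n%:R * t <= (1 + t) ^+ n by lra.
elim: n => [|n IHn]; first by rewrite mul0r addr0 expr0.
rewrite exprS; apply: le_trans (ler_wpM2l _ IHn); last by lra.
have : 0 <= n%:R * t * t by rewrite !mulr_ge0 ?ler0n.
by rewrite -natr1; lra.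
Qed.

(** With [(1 + t) ^+ 3 <= z], the Bernoulli inequality bounds [(1 + t) ^+ n] below by
    [n * t], and the cube of this eventually dominates the quadratic. *)
Lemma quadratic_le_expn (z c : R) : 1 < z -> 0 <= c ->
  exists N : nat, forall n, (N <= n)%N -> c * n.+1%:R ^+ 2 <= z ^+ n.
Proof.
move=> z1 c0; have [t [t0 tz]] : exists t, 0 < t /\ (1 + t) ^+ 3 <= z.
  exists (Num.min 1 (z - 1) / 7).
  have m0 : 0 < Num.min 1 (z - 1) by rewrite lt_min ltr01 subr_gt0.
  have m1 : Num.min 1 (z - 1) <= 1 by rewrite ge_min lexx.
  have m2 : Num.min 1 (z - 1) <= z - 1 by rewrite ge_min lexx orbT.
  split; first by rewrite divr_gt0.
  move: (Num.min 1 (z - 1)) m0 m1 m2 => m m0 m1 m2.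
  have h1 : m * m <= m by rewrite ler_piMl // ltW.
  have h2 : m * m * m <= m by apply: le_trans h1; rewrite ler_piMr ?mulr_ge0 // ltW.
  lra.
exists (Num.truncn (4 * c / t ^+ 3)).+1 => n Nn.
have hn : 4 * c <= n%:R * t ^+ 3.
  rewrite -ler_pdivrMr ?exprn_gt0 // ltW // (lt_le_trans (truncnS_gt _)) //.
  by rewrite ler_nat.
have n1 : 1 <= n%:R :> R by rewrite ler1n (leq_trans _ Nn).
apply: (@le_trans _ _ ((n%:R * t) ^+ 3)).
  have : c * n.+1%:R ^+ 2 <= c * (4 * n%:R ^+ 2).
    by rewrite ler_wpM2l // -natr1; nra.
  move=> /le_trans; apply.
  have -> : c * (4 * n%:R ^+ 2) = 4 * c * n%:R ^+ 2 by ring.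
  have -> : (n%:R * t) ^+ 3 = n%:R * t ^+ 3 * n%:R ^+ 2 by ring.
  by rewrite ler_wpM2r ?sqr_ge0.
apply: (@le_trans _ _ (((1 + t) ^+ n) ^+ 3)).
  by rewrite lerXn2r ?nnegrE ?bernoulli ?exprn_ge0 ?mulr_ge0 ?ler0n //; lra.
rewrite -exprM mulnC exprM lerXn2r ?nnegrE ?exprn_ge0 //; lra.
Qed.

Lemma chi_le_colorable d (E : set 'rV[R]_d) k : colorable E k -> (chi E <= k%:R%:E)%E.
Proof. by move=> /colorable_unit_colorable h; apply: ereal_inf_lbound; exists k. Qed.

Lemma chi_ge0 d (E : set 'rV[R]_d) : (0 <= chi E)%E.
Proof. by apply: le_ereal_inf_tmp => _ [k _ <-]; rewrite lee_fin. Qed.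

Lemma chi_ball_fin r n : 1 / 2 < r -> chi (@eball R n.+1 r) \is a fin_num.
Proof.
move=> r2; have h : xbase r * 1%:R < (Num.truncn (xbase r)).+1%:R.
  by rewrite mulr1 truncnS_gt.
have [K hK] := ball_color_growth r2 (ltnSn 0) h; have [k hk _] := hK n.
rewrite ge0_fin_numE ?chi_ge0 //; apply: le_lt_trans (chi_le_colorable hk) _.
exact: ltry.
Qed.

Lemma chi_ball_eventually r (eta : R) : 1 / 2 < r -> 0 < eta ->
  exists N : nat, forall n, (N <= n)%N ->
    (chi (@eball R n.+1 r) <= ((xbase r + eta) ^+ n)%:E)%E.
Proof.
move=> r2 eta0.
have X0 : 0 < xbase r by have := @xbase_small r (1 / 2) ltac:(lra) (ltW r2); lra.
pose v := (Num.truncn eta^-1).+1; pose u := (Num.truncn (xbase r * v%:R)).+1.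
have v0 : 0 < v%:R :> R by rewrite ltr0n.
have vE : 1 < eta * v%:R by rewrite mulrC -ltr_pdivrMr // mul1r truncnS_gt.
have u1 : xbase r * v%:R < u%:R by rewrite truncnS_gt.
have u0 : 0 < u%:R :> R by rewrite ltr0n.
have u2 : u%:R < (xbase r + eta) * v%:R.
  have : (Num.truncn (xbase r * v%:R))%:R <= xbase r * v%:R.
    by rewrite truncn_le mulr_ge0 ?ltW.
  by rewrite /u -natr1 mulrDl; lra.
have [K hK] := ball_color_growth r2 (ltn0Sn _ : (0 < v)%N) u1.
set z := (xbase r + eta) * v%:R / u%:R.
have z1 : 1 < z by rewrite ltr_pdivlMr // mul1r.
have c0 : 0 <= K%:R * (u%:R / v%:R) :> R by rewrite mulr_ge0 ?divr_ge0 ?ler0n.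
have [N hN] := quadratic_le_expn z1 c0.
exists N => n Nn; have [k kc kb] := hK n.
apply: le_trans (chi_le_colorable kc) _; rewrite lee_fin.
rewrite -(ler_nat R) !natrM !natrX in kb.
rewrite -(ler_pM2r (exprn_gt0 n.+1 v0)); apply: le_trans kb _.
have := hN n Nn.
have -> : xbase r + eta = z * (u%:R / v%:R).
  by rewrite /z mulrA divfK ?gt_eqF // mulfK ?gt_eqF.
move: z {z1 hN} => z h.
have -> : (z * (u%:R / v%:R)) ^+ n * v%:R ^+ n.+1 = z ^+ n * (v%:R / u%:R * u%:R ^+ n.+1).
  rewrite exprMn expr_div_n !exprS -!mulrA; congr (_ * _).
  by field; rewrite !gt_eqF ?exprn_gt0.
apply: le_trans (ler_wpM2r _ h); last by rewrite !mulr_ge0 ?exprn_ge0 ?invr_ge0 ?ler0n.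
rewrite le_eqVlt; apply/orP; left; apply/eqP; field.
by rewrite !gt_eqF.
Qed.

End Balls.

Theorem theorem2 (R : realType) (r : R) (hr : 1 / 2 < r) :
  exists eps : nat -> R,
    (eps n @[n --> \oo] --> (0 : R)) /\
    (forall n : nat, (0 < n)%N ->
       (chi (eball (d := n.+1) r) <= ((xbase r + eps n) ^+ n)%:E)%E).
Proof.
(* [eps n] is the excess over [xbase r] of the [n]-th root of the chromatic
   number, which exists for every [n] since the chromatic number is finite. *)
pose c n := fine (chi (@eball R n.+1 r)).
have cE n : chi (@eball R n.+1 r) = (c n)%:E by rewrite fineK // chi_ball_fin.
have c0 n : 0 <= c n by rewrite fine_ge0 // chi_ge0.
pose root n := c n `^ n%:R^-1.
have rootK n : (0 < n)%N -> root n ^+ n = c n.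
  move=> n0; rewrite -powR_mulrn ?powR_ge0 // -powRrM mulVf ?powRr1 //.
  by rewrite pnatr_eq0 -lt0n.
exists (fun n => Num.max 0 (root n - xbase r)); split; last first.
  move=> n n0; rewrite cE lee_fin -rootK // lerXn2r ?nnegrE ?powR_ge0 //.
    by rewrite (le_trans (powR_ge0 (c n) n%:R^-1)) // -lerBlDl le_max lexx orbT.
  by rewrite -lerBlDl le_max lexx orbT.
apply/cvgr0Pnorm_le => eta eta0.
have [N hN] := chi_ball_eventually hr eta0.
exists N.+1 => // n /= Nn; have n0 : (0 < n)%N by apply: leq_trans Nn.
rewrite ger0_norm ?le_max ?lexx // ge_max (ltW eta0) /= lerBlDl.
have X0 : 0 < xbase r by have := @xbase_small R r (1 / 2) ltac:(lra) (ltW hr); lra.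
have Xe0 : 0 <= xbase r + eta by rewrite addr_ge0 ?ltW.
rewrite -(@ler_pXn2r _ n) ?nnegrE ?powR_ge0 // rootK //.
by have := hN n (ltnW Nn); rewrite cE lee_fin.
Qed.
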